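(* Fix $q\in(0,1)$, put $p=1$, and let $\chi^2(p\|q)=\frac{(p-q)^2}{q(1-q)}$. Let $(\Gamma_n)$ be a sequence of planted graphs and $Q_n$ a sequence of query budgets. Let $\mathcal Q_n$ be a set of $Q_n$ pairs drawn uniformly at random from $\binom{[n]}{2}$, let $$X_{\mathrm{count}}=\sum_{e\in\mathcal Q_n}\mathbf 1\{e\in e(G)\},$$ and consider the edge-count test $$\mathcal A_{\mathrm{count}}=\mathbf 1\left\{X_{\mathrm{count}}\ge qQ_n+\lambda_n\sqrt{q(1-q)Q_n}\right\},$$ for any $\lambda_n\to\infty$. If $$\chi^2(p\|q)\cdot Q_n\cdot\left(\frac{|e(\Gamma_n)|}{\binom n2}\right)^2\to\infty ,$$ then $R_n(\mathcal A_{\mathrm{count}};\mathcal Q_n)\to0$ as $n\to\infty$.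
   Context: Setup. $\Gamma_n$ is an undirected graph without isolated vertices, with $|v(\Gamma_n)|\le n$ and edge set $e(\Gamma_n)$. Under $\mathcal H_0$, $G$ is a random graph on $[n]=\{1,\dots,n\}$ in which each pair in $\binom{[n]}{2}$ is an edge independently with probability $q$. Under $\mathcal H_1$, a copy $\Gamma_n^\star$ is drawn uniformly from the set of all subgraphs of the complete graph on $[n]$ isomorphic to $\Gamma_n$; all edges of $\Gamma_n^\star$ are in $G$ (with probability $p=1$), and every other pair is an edge independently with probability $q$. The set $\mathcal Q_n$ is a uniformly random subset of $\binom{[n]}{2}$ of size $Q_n$, drawn independently of the graph, and $e(G)$ is the edge set of $G$. Risk: $R_n(\mathcal A;\mathcal Q_n)=\mathbb P_{\mathcal H_0}(\mathcal A=1)+\mathbb P_{\mathcal H_1}(\mathcal A=0)$, the sum of the type-I and type-II error probabilities of the test $\mathcal A$ based on the answers to the queries in $\mathcal Q_n$.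
   Formalization: ''For any λ_n→∞'' is false as stated (a too large λ_n makes the test never reject); the formal theorem additionally assumes that the square root of the signal χ²(p‖q)·Q_n·(|e(Γ_n)|/C(n,2))² minus λ_n tends to infinity. *)

(* Defs.v *)
From HB Require Import structures.
From mathcomp Require Import all_boot all_order all_algebra.
From mathcomp Require Import all_classical all_reals all_analysis.

Set Implicit Arguments.
Unset Strict Implicit.
Unset Printing Implicit Defensive.

Import Order.TTheory GRing.Theory Num.Theory.
Local Open Scope ring_scope.

Record sgraph := SGraph {
  vertex :> finType;
  adj : rel vertex;
  adj_sym : symmetric adj;
  adj_irr : irreflexive adj }.

Definition no_isolated_vertex (H : sgraph) : Prop :=
  forall x : H, exists y : H, adj x y.

Definition edge_set (H : sgraph) : {set {set H}} :=
  [set e | [exists x, exists y, adj x y && (e == [set x; y])]].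

(* The unordered pairs of elements of [n]; a graph on [n] is given by its edge
   set, of type {set pair n}. *)
Definition pair (n : nat) : finType := {e : {set 'I_n} | #|e| == 2}.

Section PlantedModel.
Variables (R : realType) (n : nat).
Implicit Types (G B : {set pair n}) (S : {set 'I_n} * {set pair n}).

(* A subgraph of the complete graph on [n] is a vertex set together with a set
   of pairs lying inside it. *)
Definition is_subgraph S : bool := [forall e in S.2, val e \subset S.1].

Definition isomorphic_to (H : sgraph) S : bool :=
  [exists f : {ffun H -> 'I_n},
    [&& injectiveb f, f @: [set: H] == S.1 &
      [forall x, forall y, adj x y == ([set f x; f y] \in val @: S.2)]]].

Definition copies (H : sgraph) : {set {set 'I_n} * {set pair n}} :=
  [set S | is_subgraph S && isomorphic_to H S].

Definition unif (T : finType) (A : {set T}) (x : T) : R :=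
  (x \in A)%:R / #|A|%:R.

(* Each pair e is an edge independently with probability r e. *)
Definition edge_law (r : pair n -> R) G : R :=
  \prod_(e : pair n) (if e \in G then r e else 1 - r e).

Definition null_law (q : R) G : R := edge_law (fun=> q) G.

Definition planted_law (H : sgraph) (p q : R) G : R :=
  \sum_S unif (copies H) S * edge_law (fun e => if e \in S.2 then p else q) G.

Definition query_law (Q : nat) B : R :=
  unif [set B' : {set pair n} | #|B'| == Q] B.

(* The probability of E when the graph has law mu and the query set, independent
   of the graph, is uniform among the sets of Q pairs. *)
Definition Pr (mu : {set pair n} -> R) (Q : nat)
    (E : {set pair n} -> {set pair n} -> bool) : R :=
  \sum_G \sum_(B | E G B) mu G * query_law Q B.

(* The first argument of a test is the graph, the second the query set. *)
Definition risk (H : sgraph) (p q : R) (Q : nat)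
    (A : {set pair n} -> {set pair n} -> bool) : R :=
  Pr (null_law q) Q A + Pr (planted_law H p q) Q (fun G B => ~~ A G B).

Definition X_count G B : nat := (\sum_(e in B) (e \in G))%N.

Definition A_count (q lambda : R) (Q : nat) G B : bool :=
  q * Q%:R + lambda * Num.sqrt (q * (1 - q) * Q%:R) <= (X_count G B)%:R.

End PlantedModel.

Definition chi2 (R : realType) (p q : R) : R := (p - q) ^+ 2 / (q * (1 - q)).

Definition signal (R : realType) (n : nat) (H : sgraph) (p q : R) (Q : nat) : R :=
  chi2 p q * Q%:R * (#|edge_set H|%:R / 'C(n, 2)%:R) ^+ 2.

(* Main.v *)
(* Chebyshev's inequality under both hypotheses. If each pair e is independently
   an edge with probability r e and the query set is a uniform Q-subset of the
   N = 'C(n, 2) pairs, the events "e is queried and is an edge" are pairwise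
   negatively correlated, so the variance of the count is at most its mean
   Q / N * \sum_e r e <= Q. This covers the null law and the planted law given
   the copy of Gamma, and the mean under the latter depends only on the number of
   edges of Gamma: it exceeds q Q by sigma s with sigma = sqrt(q (1 - q) Q) and
   s = sqrt(signal). The errors are therefore O(lambda ^- 2) and
   O((s - lambda) ^- 2). *)
Require Import Defs.
From mathcomp Require Import all_boot all_order all_algebra.
From mathcomp Require Import ring lra.
From mathcomp Require Import all_classical all_reals all_analysis.

Set Implicit Arguments.
Unset Strict Implicit.
Unset Printing Implicit Defensive.

Import Order.TTheory GRing.Theory Num.Theory.
Import numFieldNormedType.Exports.
Local Open Scope ring_scope.

(** * Counting query sets and pairs *)

(** Complementation turns these sets into the subsets of [~: A] of size [#|T| - Q]. The lower index
    [#|T| - Q] also gives the right value 0 when [Q < #|A|], where a truncated [Q - #|A|] would give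
    1. *)
Lemma card_draws_superset (T : finType) (Q : nat) (A : {set T}) :
  (Q <= #|T|)%N ->
  #|[set B : {set T} | (A \subset B) && (#|B| == Q)]|
    = 'C(#|T| - #|A|, #|T| - Q).
Proof.
move=> leQ; have -> : (#|T| - #|A|)%N = #|~: A| by rewrite [RHS]cardsCs finset.setCK.
rewrite -cards_draws.
rewrite -(card_imset _ (inv_inj (@finset.setCK T))).
apply: eq_card => B; rewrite inE.
apply/imsetP/andP => [[C]|[BA /eqP cB]].
  rewrite inE => /andP[AC /eqP cC] ->; split; first by rewrite finset.setCS.
  by rewrite -cC [X in _ == (_ - X)%N]cardsCs subKn // max_card.
exists (~: B); last by rewrite finset.setCK.
rewrite inE -finset.setCS finset.setCK BA /=.
by rewrite cardsCs finset.setCK cB subKn.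
Qed.

Lemma card_pair (n : nat) : #|pair n| = 'C(n, 2).
Proof. by rewrite card_sig -[n in RHS]card_ord -card_draws cardsE. Qed.

(** * Moments of the count under independent edges *)

Section Moments.
Variables (R : realType) (n Q : nat) (r : pair n -> R).
Hypothesis leQ : (Q <= 'C(n, 2))%N.
Hypothesis r01 : forall e, 0 <= r e <= 1.

Let N := 'C(n, 2).
Let E (f : {set pair n} -> {set pair n} -> R) : R :=
  \sum_G \sum_B edge_law r G * query_law R Q B * f G B.

Lemma edge_law_ge0 G : 0 <= edge_law r G.
Proof.
by apply: prodr_ge0 => e _; case: ifP => _; have := r01 e; lra.
Qed.

Lemma unif_ge0 (T : finType) (A : {set T}) x : 0 <= unif R A x.
Proof. by rewrite /unif divr_ge0 ?ler0n. Qed.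

Lemma edge_law_superset (A : {set pair n}) :
  \sum_G edge_law r G * (A \subset G)%:R = \prod_(e in A) r e.
Proof.
(* Zeroing the non-edge weight on [A] kills, after distributing, every [G] that misses an element of
   [A]; off [A] the two weights add up to 1. *)
transitivity (\prod_(e : pair n) (r e + (if e \in A then 0 else 1 - r e))).
  rewrite bigA_distr; apply: eq_bigr => G _; rewrite /edge_law.
  have [/fintype.subsetP sAG|/subsetPn[e eA eG]] := boolP (A \subset G).
    rewrite mulr1; apply: eq_bigr => e _; case: ifPn => // eG.
    by case: ifPn => // /sAG; rewrite (negbTE eG).
  by rewrite mulr0 (bigD1 e) //= (negbTE eG) eA mul0r.
rewrite [RHS]big_mkcond; apply: eq_bigr => e _; case: ifP => _.
  by rewrite addr0.
by rewrite addrC subrK.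
Qed.

Lemma query_law_superset (A : {set pair n}) :
  \sum_B query_law R Q B * (A \subset B)%:R
    = 'C(N - #|A|, N - Q)%:R / 'C(N, Q)%:R.
Proof.
transitivity (\sum_(B in [set B : {set pair n} | (A \subset B) && (#|B| == Q)])
    'C(N, Q)%:R^-1 : R).
  rewrite [RHS]big_mkcond; apply: eq_bigr => B _.
  rewrite /query_law /unif !inE card_draws card_pair.
  by case: (A \subset B); case: (_ == Q); rewrite ?mulr0 ?mulr1 ?mul0r ?mul1r.
by rewrite sumr_const card_draws_superset card_pair // -[LHS]mulr_natl.
Qed.

(** The graph and the query set are independent, so the expectation factors. Sets [A] of one and two
    pairs give the first and second moments. *)
Lemma expect_superset (A : {set pair n}) :
  E (fun G B => ((A \subset G) && (A \subset B))%:R)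
    = (\prod_(e in A) r e) * ('C(N - #|A|, N - Q)%:R / 'C(N, Q)%:R).
Proof.
rewrite -edge_law_superset -query_law_superset mulr_suml /E.
apply: eq_bigr => G _; rewrite mulr_sumr; apply: eq_bigr => B _.
by rewrite -mulnb natrM; ring.
Qed.

Lemma eq_expect (f g : {set pair n} -> {set pair n} -> R) :
  (forall G B, f G B = g G B) -> E f = E g.
Proof.
by move=> fg; apply: eq_bigr => G _; apply: eq_bigr => B _; rewrite fg.
Qed.

Lemma expect_sum (I : finType) (F : I -> {set pair n} -> {set pair n} -> R) :
  E (fun G B => \sum_i F i G B) = \sum_i E (F i).
Proof.
rewrite /E [RHS]exchange_big; apply: eq_bigr => G _.
by rewrite [RHS]exchange_big; apply: eq_bigr => B _; rewrite mulr_sumr.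
Qed.

Let a : R := Q%:R / N%:R.

(** The pair [e] witnesses [0 < N]; for [N = 0] the left side would be 1 and [a] would be 0. *)
Lemma inclusion_prob1 (e : pair n) : 'C(N - 1, N - Q)%:R / 'C(N, Q)%:R = a.
Proof.
have N0 : (0 < N)%N by rewrite /N -card_pair; apply/card_gt0P; exists e.
have := mul_bin_down N (N - Q); rewrite subKn // bin_sub // subn1.
move/(congr1 (fun k => k%:R : R)); rewrite !natrM => h.
have C0 : 'C(N, Q)%:R != 0 :> R by rewrite pnatr_eq0 -lt0n bin_gt0.
have N0' : N%:R != 0 :> R by rewrite pnatr_eq0 -lt0n.
by apply: (mulfI N0'); rewrite mulrA h /a; field; rewrite C0 N0'.
Qed.

(** Negative correlation of sampling without replacement: the left side is
    [Q (Q - 1) / (N (N - 1))], and [(Q - 1) / (N - 1) <= Q / N] reduces to [Q <= N]. *)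
Lemma inclusion_prob2_le (e f : pair n) : e != f ->
  'C(N - 2, N - Q)%:R / 'C(N, Q)%:R <= a ^+ 2.
Proof.
move=> ef; have N1 : (1 < N)%N.
  rewrite /N -card_pair -[2%N](_ : #|[set e; f]| = 2%N) ?max_card //.
  by rewrite cards2 ef.
have C0 : 'C(N, Q)%:R != 0 :> R by rewrite pnatr_eq0 -lt0n bin_gt0.
have a0 : 0 <= a by rewrite divr_ge0 // ler0n.
have [Q0|Q0] := posnP Q.
  rewrite Q0 subn0 bin_small ?mul0r ?sqr_ge0 // ltn_subrL //.
  by rewrite (ltnW N1).
have N0' : N.-1%:R != 0 :> R by rewrite pnatr_eq0 -lt0n -ltnS prednK // ltnW.
have := mul_bin_down N.-1 (N - Q).
have -> : (N.-1 - (N - Q) = Q.-1)%N.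
  by rewrite -subn1 subnAC subKn // subn1.
move/(congr1 (fun k => k%:R : R)); rewrite !natrM => h.
have -> : 'C(N - 2, N - Q)%:R / 'C(N, Q)%:R = Q.-1%:R / N.-1%:R * a.
  rewrite -(inclusion_prob1 e) subn1.
  have -> : (N - 2 = N.-1.-1)%N by rewrite subn2.
  by apply: (mulfI N0'); rewrite [LHS]mulrA h; field; rewrite C0 N0'.
rewrite expr2 ler_wpM2r // /a.
rewrite ler_pdivrMr ?lt0r ?N0' ?ler0n // mulrAC ler_pdivlMr ?ltr0n ?(ltnW N1) //.
rewrite -!natrM ler_nat -!subn1 mulnBl mulnBr mul1n muln1.
by apply: leq_sub2l.
Qed.

Let M : R := a * \sum_e r e.

Lemma X_countE (G B : {set pair n}) :
  (X_count G B)%:R = \sum_e (([set e] \subset G) && ([set e] \subset B))%:R :> R.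
Proof.
rewrite /X_count big_mkcond natr_sum; apply: eq_bigr => e _.
by rewrite !finset.sub1set; case: (e \in B); rewrite ?andbF ?andbT.
Qed.

Lemma expect_X_count : E (fun G B => (X_count G B)%:R) = M.
Proof.
rewrite (eq_expect X_countE) expect_sum /M mulr_sumr; apply: eq_bigr => e _.
by rewrite expect_superset big_set1 cards1 (inclusion_prob1 e) mulrC.
Qed.

Lemma expect_X_count_sq_le : E (fun G B => (X_count G B)%:R ^+ 2) <= M ^+ 2 + M.
Proof.
rewrite (@eq_expect _ (fun G B =>
    \sum_e \sum_f (([set e; f] \subset G) && ([set e; f] \subset B))%:R)); last first.
  move=> G B.
  rewrite X_countE expr2 mulr_suml; apply: eq_bigr => e _.
  rewrite mulr_sumr; apply: eq_bigr => f _.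
  by rewrite -natrM mulnb !finset.subUset andbACA.
rewrite expect_sum.
(* The bound is split by rows, so that row [e] of the double sum is compared with its own share. *)
have -> : M ^+ 2 + M = \sum_e (a ^+ 2 * \sum_f r e * r f + a * r e).
  rewrite big_split /= -!mulr_sumr /M exprMn; congr (_ * _ + _).
  by rewrite expr2 mulr_suml; apply: eq_bigr => e _; rewrite mulr_sumr.
apply: ler_sum => e _; rewrite expect_sum.
have r0 g : 0 <= r g by case/andP: (r01 g).
rewrite mulr_sumr (bigD1 e) //= [X in _ <= X + _](bigD1 e) //=.
rewrite expect_superset finset.setUid big_set1 cards1 (inclusion_prob1 e).
rewrite [_ + a * _]addrC addrA [r e * a]mulrC; apply: lerD.
  (* The diagonal term equals [a * r e]; the slack is the nonnegative [a ^+ 2 * (r e * r e)] that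
     completes [M ^+ 2]. *)
  by rewrite lerDl !mulr_ge0 ?sqr_ge0.
apply: ler_sum => f fe; rewrite expect_superset cards2 eq_sym fe /=.
rewrite big_setU1 ?inE 1?eq_sym // big_set1 mulrC.
apply: ler_wpM2r; first by rewrite mulr_ge0.
exact: inclusion_prob2_le fe.
Qed.

Lemma X_count_variance_le :
  E (fun G B => ((X_count G B)%:R - M) ^+ 2) <= M.
Proof.
have total : E (fun _ _ => 1) = 1.
  (* Total mass 1 is the superset formula for the empty set; [leQ] ensures that a query set of size
     [Q] exists. *)
  have := expect_superset finset.set0; rewrite finset.big_set0 cards0 subn0 bin_sub //.
  rewrite divff ?mulr1 ?pnatr_eq0 -?lt0n ?bin_gt0 // => h.
  by rewrite -[RHS]h; apply: eq_expect => G B; rewrite !finset.sub0set.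
have -> : E (fun G B => ((X_count G B)%:R - M) ^+ 2)
  = E (fun G B => (X_count G B)%:R ^+ 2) - 2 * M * E (fun G B => (X_count G B)%:R)
    + M ^+ 2 * E (fun _ _ => 1).
  rewrite /E !mulr_sumr -sumrB -big_split; apply: eq_bigr => G _ /=.
  rewrite !mulr_sumr -sumrB -big_split; apply: eq_bigr => B _ /=.
  by ring.
rewrite total expect_X_count; have := expect_X_count_sq_le; lra.
Qed.

Lemma X_count_mean_le : M <= Q%:R.
Proof.
have [N0|N0] := posnP N.
  by rewrite /M /a N0 invr0 mulr0 mul0r ler0n.
have s : \sum_e r e <= N%:R.
  rewrite /N -card_pair -sumr_const.
  by apply: ler_sum => e _; case/andP: (r01 e).
apply: le_trans (ler_wpM2l _ s) _; first by rewrite divr_ge0 ?ler0n.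
by rewrite /a divfK // pnatr_eq0 -lt0n.
Qed.

(** Bounding the variance by [Q] instead of [M] gives one estimate for both hypotheses, independent
    of [r]. *)
Lemma X_count_chebyshev (t : R) (A : {set pair n} -> {set pair n} -> bool) :
    0 < t -> (forall G B, A G B -> t <= `|(X_count G B)%:R - M|) ->
  Pr (edge_law r) Q A <= Q%:R / t ^+ 2.
Proof.
move=> t0 hA; rewrite ler_pdivlMr ?exprn_gt0 //.
apply: le_trans X_count_mean_le; apply: le_trans X_count_variance_le.
rewrite /Pr /E mulr_suml; apply: ler_sum => G _.
rewrite mulr_suml big_mkcond; apply: ler_sum => B _.
have w0 : 0 <= edge_law r G * query_law R Q B.
  by rewrite mulr_ge0 ?edge_law_ge0 ?unif_ge0.
case: ifP => [/hA AGB|_]; last by rewrite mulr_ge0 ?sqr_ge0.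
by rewrite ler_wpM2l // -[leRHS]real_normK ?num_real // lerXn2r ?nnegrE // ltW.
Qed.

End Moments.

(** * Copies of the planted graph *)

Lemma card_copy (n : nat) (H : sgraph) (S : {set 'I_n} * {set pair n}) :
  S \in copies n H -> #|S.2| = #|edge_set H|.
Proof.
rewrite inE => /andP[/forall_inP subS /existsP[f /and3P[/injectiveP injf]]].
move=> /eqP fS /forallP adjf.
have {}adjf x y : adj x y = ([set f x; f y] \in val @: S.2).
  by apply/eqP; move/forallP: (adjf x).
rewrite -(card_imset _ val_inj) -(card_imset (mem (edge_set H)) (imset_inj injf)).
apply: eq_card => e; apply/idP/imsetP.
  move=> eS; have /imsetP[d dS de] := eS.
  have /cards2P[a [b [_ dab]]] := valP d.
  (* [isomorphic_to] only sees pairs inside the image of [f]; [is_subgraph] excludes edges with an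
     endpoint elsewhere. *)
  have := subS d dS; rewrite dab -fS => /fintype.subsetP sub.
  have /imsetP[x _ ax] : a \in f @: [set: H] by apply: sub; rewrite !inE eqxx.
  have /imsetP[y _ bY] : b \in f @: [set: H] by apply: sub; rewrite !inE eqxx orbT.
  exists [set x; y]; last by rewrite de dab ax bY imsetU1 imset_set1.
  rewrite inE; apply/existsP; exists x; apply/existsP; exists y.
  by rewrite eqxx andbT adjf -ax -bY -dab -de.
move=> [d]; rewrite inE => /existsP[x /existsP[y /andP[xy /eqP ->]]] ->.
by rewrite imsetU1 imset_set1 -adjf.
Qed.

(** For empty [A] all weights are 0, hence an inequality; it is what averaging an upper bound over
    the copies requires. *)
Lemma sum_unif_le1 (R : realType) (T : finType) (A : {set T}) :
  \sum_x unif R A x <= 1.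
Proof.
rewrite /unif -mulr_suml -natr_sum -big_mkcond sum1_card.
have [->|A0] := eqVneq #|A| 0%N; first by rewrite mul0r ler01.
by rewrite divff // pnatr_eq0.
Qed.

(** * Error bounds for a fixed [n] *)

Section TestErrors.
Variables (R : realType) (n Q : nat) (q lambda : R).
Hypothesis leQ : (Q <= 'C(n, 2))%N.
Hypothesis Q0 : (0 < Q)%N.
Hypothesis hq : 0 < q < 1.

Let sigma := Num.sqrt (q * (1 - q) * Q%:R).

Let var_gt0 : 0 < q * (1 - q) * Q%:R.
Proof. by case/andP: hq => q0 q1; rewrite !mulr_gt0 ?subr_gt0 ?ltr0n. Qed.

Let sigma_gt0 : 0 < sigma.
Proof. by rewrite sqrtr_gt0. Qed.

(** [Q] cancels because [sigma ^+ 2 = q * (1 - q) * Q], so the error depends only on the distance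
    [t] in units of [sigma]. *)
Let bound (t : R) : 0 < t ->
  Q%:R / (t * sigma) ^+ 2 = (q * (1 - q))^-1 * (t^-1 * t^-1).
Proof.
move=> t0; case/andP: hq => q0 q1; rewrite exprMn sqr_sqrtr ?ltW //.
have Q0' : Q%:R != 0 :> R by rewrite pnatr_eq0 -lt0n.
by field; rewrite Q0' !gt_eqF ?subr_gt0.
Qed.

Let pairs_neq0 : 'C(n, 2)%:R != 0 :> R.
Proof. by rewrite pnatr_eq0 -lt0n (leq_trans Q0). Qed.

Lemma type_I_error_le : 0 < lambda ->
  Pr (null_law q) Q (@A_count R n q lambda Q)
    <= (q * (1 - q))^-1 * (lambda^-1 * lambda^-1).
Proof.
move=> l0; rewrite -bound //; case/andP: hq => q0 q1.
apply: X_count_chebyshev => //.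
- by move=> e; rewrite !ltW.
- by rewrite mulr_gt0.
move=> G B; rewrite /A_count -/sigma sumr_const card_pair => AGB.
apply: le_trans (ler_norm _).
by rewrite -[q *+ _]mulr_natr mulrCA divfK // lerBrDl.
Qed.

Let planted_chebyshev (H : sgraph) (S : {set 'I_n} * {set pair n}) :
  let s := Num.sqrt (signal n H 1 q Q) in
  lambda < s -> S \in copies n H ->
  Pr (edge_law (fun e => if e \in S.2 then 1 else q)) Q
      (fun G B => ~~ A_count q lambda Q G B)
    <= (q * (1 - q))^-1 * ((s - lambda)^-1 * (s - lambda)^-1).
Proof.
move=> s ls SH; have sl0 : 0 < s - lambda by rewrite subr_gt0.
rewrite -bound //; case/andP: hq => q0 q1.
have Q0' : 0 < Q%:R :> R by rewrite ltr0n.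
apply: X_count_chebyshev => //.
- by move=> e; case: ifP; rewrite ?ler01 ?lexx ?ltW.
- by rewrite mulr_gt0.
move=> G B; rewrite /A_count -/sigma -ltNge => AGB.
set m := #|edge_set H|%:R : R.
(* Each edge of the copy raises its probability from [q] to 1. *)
have sum_r : \sum_(e : pair n) (if e \in S.2 then 1 else q)
    = q * 'C(n, 2)%:R + (1 - q) * m.
  rewrite /m -(card_copy SH) -card_pair -!sum1_card !natr_sum.
  rewrite [X in _ + _ * X]big_mkcond !mulr_sumr -big_split.
  by apply: eq_bigr => e _ /=; case: ifP => _; ring.
(* With [p = 1], [chi2] is [(1 - q) / q], so [sigma ^+ 2] times the signal is the square of the
   shift of the mean. *)
have shift : sigma * s = Q%:R / 'C(n, 2)%:R * ((1 - q) * m).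
  rewrite /sigma /s -sqrtrM ?(ltW var_gt0) //.
  have -> : q * (1 - q) * Q%:R * signal n H 1 q Q
      = (Q%:R / 'C(n, 2)%:R * ((1 - q) * m)) ^+ 2.
    rewrite /signal /chi2 -/m; field.
    by rewrite pairs_neq0 !gt_eqF ?subr_gt0.
  rewrite sqrtr_sqr ger0_norm // !mulr_ge0 ?invr_ge0 ?ler0n //.
  by rewrite subr_ge0 ltW.
rewrite sum_r mulrDr -shift [q * _]mulrC mulrA divfK //.
rewrite -normrN; apply: le_trans (ler_norm _).
by move: AGB; rewrite -/sigma; lra.
Qed.

Lemma type_II_error_le (H : sgraph) :
  let s := Num.sqrt (signal n H 1 q Q) in
  lambda < s ->
  Pr (planted_law H 1 q) Q (fun G B => ~~ @A_count R n q lambda Q G B)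
    <= (q * (1 - q))^-1 * ((s - lambda)^-1 * (s - lambda)^-1).
Proof.
move=> s ls; set c := leRHS.
have c0 : 0 <= c.
  case/andP: hq => q0 q1.
  by rewrite /c -expr2 mulr_ge0 ?sqr_ge0 // invr_ge0 mulr_ge0 ?subr_ge0 ?ltW.
set A := (fun G B => _).
(* [Pr] is linear in the graph law, so the type-II error is an average over copies, and the bound is
   the same for each copy. *)
have -> : Pr (planted_law H 1 q) Q A = \sum_S unif R (copies n H) S *
    Pr (edge_law (fun e => if e \in S.2 then 1 else q)) Q A.
  rewrite /Pr; under [RHS]eq_bigr do rewrite mulr_sumr.
  rewrite [RHS]exchange_big; apply: eq_bigr => G _ /=.
  under [RHS]eq_bigr do rewrite mulr_sumr.
  rewrite [RHS]exchange_big; apply: eq_bigr => B _ /=.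
  by rewrite /planted_law mulr_suml; apply: eq_bigr => S _; rewrite mulrA.
rewrite -[leRHS]mul1r; apply: le_trans (ler_wpM2r c0 (sum_unif_le1 R (copies n H))).
rewrite mulr_suml; apply: ler_sum => S _.
have [SH|SH] := boolP (S \in copies n H).
  by apply: ler_wpM2l; [exact: unif_ge0|exact: planted_chebyshev].
by rewrite /unif (negbTE SH) !mul0r.
Qed.

End TestErrors.

(** * Nonnegativity of the risk and passage to the limit *)

Lemma Pr_ge0 (R : realType) (n Q : nat) (mu : {set pair n} -> R) A :
  (forall G, 0 <= mu G) -> 0 <= Pr mu Q A.
Proof.
move=> mu0; apply: sumr_ge0 => G _; apply: sumr_ge0 => B _.
by rewrite mulr_ge0 ?unif_ge0.
Qed.

Lemma risk_ge0 (R : realType) (n Q : nat) (H : sgraph) (p q : R) A :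
  0 <= p <= 1 -> 0 <= q <= 1 -> 0 <= risk (n := n) H p q Q A.
Proof.
move=> p01 q01; rewrite addr_ge0 // Pr_ge0 // => G; first exact: edge_law_ge0.
apply: sumr_ge0 => S _; rewrite mulr_ge0 ?unif_ge0 // edge_law_ge0 // => e.
by case: ifP.
Qed.

Local Open Scope classical_set_scope.

(** [hslow] makes precise how slowly [lambda] grows: the threshold must fall below the planted mean
    by ever more multiples of [sigma]. Were it above by ever more, Chebyshev would send the type-II
    error to 1. *)
Theorem theorem5 (R : realType) (q : R) (hq : 0 < q < 1)
  (Gamma : nat -> sgraph)
  (hisol : forall n, no_isolated_vertex (Gamma n))
  (hvert : forall n, (#|Gamma n| <= n)%N)
  (Q : nat -> nat) (hQ : forall n, (Q n <= 'C(n, 2))%N)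
  (hsignal : signal n (Gamma n) 1 q (Q n) @[n --> \oo] --> +oo)
  (lambda : nat -> R)
  (hlambda : lambda n @[n --> \oo] --> +oo)
  (hslow : Num.sqrt (signal n (Gamma n) 1 q (Q n)) - lambda n
             @[n --> \oo] --> +oo) :
  risk (n := n) (Gamma n) 1 q (Q n) (A_count q (lambda n) (Q n))
    @[n --> \oo] --> (0 : R).
Proof.
set d := fun n => Num.sqrt (signal n (Gamma n) 1 q (Q n)) - lambda n.
have lambda_gt0 : \forall n \near \oo, 0 < lambda n by exact: cvgry_gt.
have d_gt0 : \forall n \near \oo, 0 < d n by exact: cvgry_gt.
have inv0 (u : nat -> R) : (\forall n \near \oo, 0 < u n) ->
    u n @[n --> \oo] --> +oo -> (u n)^-1 * (u n)^-1 @[n --> \oo] --> (0 : R).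
  move=> u0 uoo; rewrite -[X in _ --> X](mulr0 0).
  by apply: cvgM; apply/(gtr0_cvgV0 u0).
pose h n : R := (q * (1 - q))^-1 * ((lambda n)^-1 * (lambda n)^-1)
  + (q * (1 - q))^-1 * ((d n)^-1 * (d n)^-1).
have h0 : h n @[n --> \oo] --> (0 : R).
  rewrite -[X in _ --> X](addr0 0) -{1}(mulr0 (q * (1 - q))^-1).
  rewrite -{2}(mulr0 (q * (1 - q))^-1).
  by apply: cvgD; apply: cvgMr; apply: inv0.
apply: (squeeze_cvgr _ (cvg_cst 0) h0); near=> n.
have ln0 : 0 < lambda n by near: n.
have dn0 : 0 < d n by near: n.
(* An empty budget would make the signal 0 and [d n = - lambda n] negative. *)
have Q0 : (0 < Q n)%N.
  rewrite lt0n; apply/eqP => Qn0; move: dn0.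
  by rewrite /d /signal Qn0 mulr0 mul0r sqrtr0 sub0r oppr_gt0 ltNge ltW.
apply/andP; split.
  by apply: risk_ge0; rewrite ?ler01 ?lexx //; case/andP: hq => *; rewrite !ltW.
rewrite /risk /h; apply: lerD; first exact: type_I_error_le.
by apply: type_II_error_le; rewrite // -subr_gt0.
Unshelve. all: by end_near.
Qed.
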